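(* (Regression discontinuity design.) Let $\mathbb{P}$ be the class of regression discontinuity models defined in the context, with $\mu(P)$ the size of the jump of the conditional mean at the cutoff $c$, and let $n\ge1$ be the sample size. For every $m\in\mathbb{R}$ let $\mathbb{P}_{0,m}=\{P\in\mathbb{P}:\mu(P)=m\}$ and $\mathbb{P}_{1,m}=\mathbb{P}\setminus\mathbb{P}_{0,m}$. Then for every $m\in\mathbb{R}$ and every $Q\in\mathbb{P}_{1,m}$ there is a sequence in the convex hull of $\{P^{\otimes n}:P\in\mathbb{P}_{0,m}\}$ converging in distribution to $Q^{\otimes n}$. Consequently: (i) for every $m\in\mathbb{R}$, every test $\phi_m(Z)$ for the value $m$ of the discontinuity that is a.s. continuous under $Q^{\otimes n}$ for every $Q\in\mathbb{P}_{1,m}$ has power limited by size: $\sup_{Q\in\mathbb{P}_{1,m}}\mathbb{E}_{Q^{\otimes n}}[\phi_m]\le\sup_{P\in\mathbb{P}_{0,m}}\mathbb{E}_{P^{\otimes n}}[\phi_m]$; (ii) every confidence set $C(Z)\subseteq\mathbb{R}$ for the value of the discontinuity $\mu(P)$ that has finite expected length has zero confidence level: $\inf_{P\in\mathbb{P}}P^{\otimes n}[\mu(P)\in C(Z)]=0$.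
   Context: Let $\mathbb{X}\subseteq\mathbb{R}$ be an interval and $c$ a point in its interior. $\mathcal{G}$ is the set of bounded functions $g:\mathbb{X}\to\mathbb{R}$ that are infinitely many times continuously differentiable at every $x\in\mathbb{X}\setminus\{c\}$ and have one-sided limits at $c$; the size of the discontinuity at $c$ may take any value in $\mathbb{R}$. $\mathbb{P}$ is the set of all distributions $P$ of a pair $(X_i,Y_i)$ of real random variables such that $X_i$ has a continuous probability density function with support $\mathbb{X}$ and there is $g\in\mathcal{G}$ with $\mathbb{E}_P[Y_i\mid X_i=x]=g(x)$. The parameter is $\mu(P)=\lim_{x\downarrow c}\mathbb{E}_P[Y_i\mid X_i=x]-\lim_{x\uparrow c}\mathbb{E}_P[Y_i\mid X_i=x]$, computed with the version $g$. The data are $Z=(Z_1,\dots,Z_n)$ with $Z_i=(X_i,Y_i)$ i.i.d. with distribution $P$, so $Z\sim P^{\otimes n}$. A test is a measurable function of $Z$ with values in $[0,1]$; it is a.s. continuous under a distribution if its set of discontinuity points has probability zero under that distribution. The convex hull of a set of distributions is the set of finite mixtures of its elements. A confidence set is a set-valued function $C(Z)$ of the data; its length is $\sup C(Z)-\inf C(Z)$, and finite expected length means that the expectation of the length is finite under every $P\in\mathbb{P}$. *)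

(* Defs.v *)
From HB Require Import structures.
From mathcomp Require Import all_boot all_order all_algebra.
From mathcomp Require Import all_classical all_reals all_analysis.
From mathcomp Require Import measurable_realfun.

Set Implicit Arguments.
Unset Strict Implicit.
Unset Printing Implicit Defensive.

Import Order.TTheory GRing.Theory Num.Theory.
Import numFieldNormedType.Exports.

Local Open Scope classical_set_scope.
Local Open Scope ring_scope.

(* The product topology on tuples, so that continuity of a function of the
   sample makes sense; the product sigma-algebra is already in the library. *)
HB.instance Definition _ (n : nat) (T : topologicalType) :=
  Topological.copy (n.-tuple T)
    (initial_topology
       ((fun z : n.-tuple T => tnth z) : _ -> {ptws 'I_n -> T})).

Section product_power.
Context d (T : measurableType d) (R : realType).

Definition cons_pair (n : nat) (p : T * n.-tuple T) : n.+1.-tuple T :=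
  [tuple of p.1 :: p.2].

Lemma measurable_cons_pair n : measurable_fun setT (@cons_pair n).
Proof. by apply: measurable_cons. Qed.

HB.instance Definition _ n :=
  isMeasurableFun.Build _ _ _ _ (@cons_pair n) (@measurable_cons_pair n).

Fixpoint product_power (P : probability T R) (n : nat) :
    probability (n.-tuple T) R :=
  if n is n'.+1 then distribution (P \x product_power P n')%E (@cons_pair n')
  else \d_([tuple] : 0.-tuple T).

Lemma product_powerE (P : probability T R) n (A : 'I_n -> set T) :
  (forall i, measurable (A i)) ->
  product_power P n [set z | forall i, A i (tnth z i)] =
  (\prod_(i < n) P (A i))%E.
Proof.
elim: n A => [|n IH] A mA.
  rewrite big_ord0 /= diracE mem_set//=.
  by case.
rewrite big_ord_recl /= /pushforward.
have -> : @cons_pair n @^-1` [set z | forall i, A i (tnth z i)] =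
    A ord0 `*` [set z | forall i, A (lift ord0 i) (tnth z i)].
  apply/seteqP; split => -[x z] /=.
    move=> h; split; first by have := h ord0; rewrite tnth0.
    by move=> i; have := h (lift ord0 i); rewrite tnthS.
  move=> [Ax Az] i; case: (unliftP ord0 i) => [k ->|->].
    by rewrite tnthS.
  by rewrite tnth0.
have mB : measurable [set z : n.-tuple T |
    forall i, A (lift ord0 i) (tnth z i)].
  have -> : [set z : n.-tuple T | forall i, A (lift ord0 i) (tnth z i)] =
      \bigcap_(i in [set: 'I_n]) ((@tnth _ T ^~ i) @^-1` A (lift ord0 i)).
    by apply/seteqP; split => z /= h i; [move=> _|]; exact: h.
  apply: fin_bigcap_measurable => // i _.
  rewrite -[_ @^-1` _]setTI; exact: measurable_tnth.
rewrite product_measure1E//; congr (_ * _)%E.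
exact: IH.
Qed.

End product_power.

Section inference.
Context d (T : measurableType d) (R : realType).
Implicit Types S : set (probability T R).

Definition convex_hull S : set (probability T R) :=
  [set nu | exists (k : nat) (w : 'I_k -> R) (p : 'I_k -> probability T R),
     [/\ forall i, 0 <= w i, \sum_(i < k) w i = 1, forall i, S (p i) &
         forall A, measurable A ->
           nu A = (\sum_(i < k) (w i)%:E * p i A)%E]].

Definition is_test (phi : T -> R) :=
  measurable_fun setT phi /\ forall z, 0 <= phi z <= 1.

(* For C = set0 the difference sup C - inf C would be -oo - +oo. *)
Definition set_length (C : set R) : \bar R :=
  if C == set0 then 0%E
  else (ereal_sup (EFin @` C) - ereal_inf (EFin @` C))%E.

(* Measurability is what makes coverage probabilities and the expectation of
   the length meaningful. *)
Definition is_confidence_set (C : T -> set R) :=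
  (forall r, measurable [set z | C z r]) /\
  measurable_fun setT (fun z => set_length (C z)).

End inference.

Section sample.
Context (R : realType) (n : nat).
Local Notation sample := (n.-tuple (R * R)%type).

Definition cvg_in_distribution (nu_ : nat -> probability sample R)
    (nu : probability sample R) :=
  forall h : sample -> R, continuous h ->
    (exists M : R, forall z, `|h z| <= M) ->
    ('E_(nu_ k)[h] @[k --> \oo] --> 'E_nu[h])%E.

Definition as_continuous (P : probability sample R) (phi : sample -> R) :=
  P.-negligible [set z | ~ {for z, continuous phi}].

End sample.

Section rdd.
Context (R : realType) (X : set R) (c : R).
Implicit Types (P : probability (R * R)%type R) (f g : R -> R).

(* At an endpoint of X lying in X this is the one-sided derivative. *)
Definition derivative_within (h : R -> R) (x l : R) :=
  (h y - h x) / (y - x) @[y --> within X x^'] --> l.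

(* G k is the k-th derivative of g; its continuity at the points of X other
   than c follows from its differentiability there. *)
Definition smooth_off_cutoff g :=
  exists2 G : nat -> R -> R, G 0%N = g &
    forall k x, X x -> x != c -> derivative_within (G k) x (G k.+1 x).

(* Functions X -> R are represented by functions on R of which only the values
   on X matter. *)
Definition regression_function g :=
  [/\ exists M : R, forall x, X x -> `|g x| <= M,
      smooth_off_cutoff g,
      cvg (g x @[x --> c^'-]) &
      cvg (g x @[x --> c^'+])].

(* Continuity is on X and the support is the closure of where f is nonzero, so
   that for instance the uniform law on a compact X is allowed. *)
Definition continuous_density P f :=
  [/\ {within X, continuous f},
      forall x, 0 <= f x,
      forall x, ~ X x -> f x = 0,
      closure [set x | f x != 0] = closure X &
      forall A, measurable A ->
        P (fst @^-1` A) = (\int[lebesgue_measure]_(x in A) (f x)%:E)%E].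

(* E_P[Y_i | X_i = x] = g(x), in integrated form over events {X_i in A}; A is
   taken inside X because g may be anything outside X. *)
Definition conditional_mean P g :=
  P.-integrable setT (fun z => (z.2)%:E) /\
  forall A, measurable A -> A `<=` X ->
    (\int[P]_(z in fst @^-1` A) (z.2)%:E =
     \int[P]_(z in fst @^-1` A) (g z.1)%:E)%E.

Definition regression_version P g :=
  regression_function g /\ conditional_mean P g.

Definition rdd_model : set (probability (R * R)%type R) :=
  [set P | (exists f, continuous_density P f) /\
           (exists g, regression_version P g)].

Definition jump g : R := lim (g x @[x --> c^'+]) - lim (g x @[x --> c^'-]).

(* For P in the model any two versions agree on X except possibly at c, so the
   choice of g does not matter. *)
Definition rdd_mu P : R := jump (xget (cst 0) [set g | regression_version P g]).

Definition rdd_null (m : R) := [set P | rdd_model P /\ rdd_mu P = m].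

Definition rdd_alternative (m : R) := rdd_model `\` rdd_null m.

End rdd.

(* Main.v *)
From HB Require Import structures.
Require Import Defs.
From mathcomp Require Import all_boot all_order all_algebra.
From mathcomp Require Import all_classical all_reals all_analysis.
From mathcomp Require Import measurable_realfun ring lra.

Set Implicit Arguments.
Unset Strict Implicit.
Unset Printing Implicit Defensive.

Import Order.TTheory GRing.Theory Num.Theory.
Import numFieldNormedType.Exports.

Local Open Scope classical_set_scope.
Local Open Scope ring_scope.

(* Given [Q] in the model and a target [m], add to [Y] a bounded function of [X]
   that is smooth off [c], supported in [c, c + 1/(k+1)], and jumps at [c] by the
   amount needed to make the total jump [m].  The resulting law has the same
   density of [X] and lies in the null class.  As [X = c] has probability zero,
   almost every sample is unchanged for large [k], so by dominated convergence
   the expectation of every bounded measurable function of the sample converges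
   to its value under [Q].  A confidence set covering every parameter with
   probability at least [b > 0] would therefore cover every real number with
   probability at least [b] under a single [Q]; events of covering points further
   apart than the typical length are disjoint, which bounds their number. *)

(** * Functions vanishing to infinite order at the origin *)

Section flat_function.
Context {R : realType}.
Implicit Types (p : {poly R}) (t : R).

(** The polynomial factor makes the family closed under differentiation, so that it contains
    exp(-1/t) together with all its derivatives. *)
Definition flat p t : R := if 0 < t then p.[t^-1] * expR (- t^-1) else 0.

(** A single term of the exponential series gives s^j / j! <= exp s for s >= 0; the bound is then
    summed over the coefficients of [p]. *)
Lemma poly_expR_bounded p :
  exists2 C : R, 0 <= C & forall s : R, 0 <= s -> `|p.[s]| * expR (- s) <= C.
Proof.
exists (\sum_(i < size p) `|p`_i| * i`!%:R).
  by apply: sumr_ge0 => i _; rewrite mulr_ge0.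
move=> s s0; rewrite horner_coef.
rewrite (@le_trans _ _ ((\sum_(i < size p) `|p`_i| * s ^+ i) * expR (- s)))//.
  rewrite ler_wpM2r ?expR_ge0// (le_trans (ler_norm_sum _ _ _))//.
  by apply: ler_sum => i _; rewrite normrM normrX (ger0_norm s0).
suff bnd j : s ^+ j / expR s <= j`!%:R.
  by rewrite mulr_suml; apply: ler_sum => i _; rewrite -mulrA ler_wpM2l// expRN.
rewrite ler_pdivrMr ?expR_gt0//.
case: j => [|j]; first by rewrite expr0 fact0 mul1r -expR0 ler_expR.
have := expR_ge1Dxn j s0; rewrite -lerBrDl => /le_trans.
rewrite -ler_pdivrMl ?ltr0n ?fact_gt0// mulrC; apply.
by rewrite gerBl.
Qed.

Lemma flat_bounded p : exists2 C : R, 0 <= C & forall t, `|flat p t| <= C.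
Proof.
have [C C0 pC] := poly_expR_bounded p; exists C => // t.
rewrite /flat; case: ifPn => t0; last by rewrite normr0.
by rewrite normrM (ger0_norm (expR_ge0 _)) pC// invr_ge0 ltW.
Qed.

(** With s = 1/t one has ds/dt = -s^2, so for t > 0 the product rule applied to p(s) exp(-s) gives
    s^2 (p(s) - p'(s)) exp(-s). The point 0 is treated through its difference quotient. *)
Lemma is_derive_flat p t :
  is_derive t 1 (flat p) (flat ('X^2 * (p - p^`())) t).
Proof.
have [t0|t0|->] := ltgtP t 0.
- rewrite {2}/flat ltNge (ltW t0)/=.
  apply: (@near_eq_is_derive _ _ _ (cst 0)) => //.
  near=> u; rewrite /flat ltNge; have -> //: u <= 0.
  by near: u; exact: lt_le_nbhsl.
- have tn0 : t != 0 by rewrite gt_eqF.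
  apply: (@near_eq_is_derive R R R (fun u : R => p.[u^-1] * expR (- u^-1)) (flat p)).
    near=> u; rewrite /flat; have -> //: 0 < u.
    by near: u; exact: lt_nbhsr.
  have dV : is_derive t 1 (fun u : R => u^-1) (- t ^- 2).
    by rewrite -[- _]mulr1; exact: (@is_deriveV _ id).
  have d1 : is_derive t 1 (fun u => p.[u^-1]) (p^`().[t^-1] * (- t ^- 2)).
    exact: (@is_derive1_comp _ _ _ _ _ _ (is_derive_poly p _) dV).
  have d2 : is_derive t 1 (fun u => expR (- u^-1)) (expR (- t^-1) * t ^- 2).
    have dN : is_derive t 1 (fun u : R => - u^-1) (t ^- 2).
      by apply: is_derive_eq; rewrite opprK.
    exact: (@is_derive1_comp _ _ _ _ _ _ (is_derive_expR _) dN).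
  apply: is_derive_eq.
  rewrite /flat t0 !hornerE/= -!exprVn.
  rewrite /GRing.scale/=; ring.
rewrite {2}/flat ltxx.
(* For h > 0 the quotient at 0 is h times the value at h of [flat ('X^2 * p)], a bounded
   function. *)
have [C C0 pC] := flat_bounded ('X^2 * p).
have h : h^-1 *: (flat p (h *: 1 + 0) - flat p 0) @[h --> 0^'] --> (0 : R).
  apply/cvgr0Pnorm_le => e e0; near=> h.
  have hn0 : h != 0 by near: h; exact: nbhs_dnbhs_neq.
  rewrite [_%:A]mulr1 addr0 {2}/flat ltxx subr0.
  have := pC h; rewrite /flat; case: ifPn => h0; last first.
    by move=> _; rewrite scaler0 normr0 ltW.
  rewrite !hornerE /GRing.scale/= => ph.
  have -> : h^-1 * (p.[h^-1] * expR (- h^-1)) =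
    h * (h^-1 ^+ 2 * p.[h^-1] * expR (- h^-1)) by field.
  rewrite normrM (@le_trans _ _ (`|h| * C)) ?ler_wpM2l//.
  (* [C] may be 0; [C + 1] can be divided by. *)
  rewrite (@le_trans _ _ (`|h| * (C + 1))) ?ler_wpM2l ?lerDl//.
  rewrite -ler_pdivlMr ?ltr_wpDl//.
  near: h; apply: dnbhs0_le; rewrite divr_gt0// ltr_wpDl//.
by apply: DeriveDef; [apply/cvg_ex; exists 0|exact: cvg_lim h].
Unshelve. all: by end_near. Qed.

End flat_function.

(** * Smooth bumps to the right of the cutoff with a prescribed jump *)

Section spike.
Context {R : realType}.
Implicit Types (X : set R) (c d e x l : R) (h : R -> R).

Lemma is_derive_within X h x l : is_derive x 1 h l -> derivative_within X h x l.
Proof.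
move=> [dh <-]; apply: (@cvg_trans _ ((h y - h x) / (y - x) @[y --> x^'])).
  exact/cvg_app/cvg_within.
have sub0 : (y - x) @[y --> x^'] --> (0 : R)^'.
  move=> A [e /= e0 eA]; exists e => //= y yx ynx.
  by apply: eA; rewrite /= ?subr_eq0// sub0r normrN distrC.
apply: cvg_trans (cvg_comp _ _ sub0 dh); apply: near_eq_cvg.
by near=> y; rewrite /= [_%:A]mulr1 subrK [LHS]mulrC.
Unshelve. all: by end_near. Qed.

Lemma flat_continuous (p : {poly R}) : continuous (flat p).
Proof.
move=> t; apply: differentiable_continuous; apply/derivable1_diffP.
by have [] := is_derive_flat p t.
Qed.

(** For e > 0 the argument 1 - e (x - c) equals 1 at the cutoff and reaches 0 at c + 1/e, where the
    bump dies out smoothly. Each differentiation contributes a factor -e and one more application of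
    the operator found in [is_derive_flat]. *)
Definition spike_deriv c d e (j : nat) x : R :=
  if x < c then 0 else
  d * expR 1 * (- e) ^+ j *
  flat (iter j (fun p : {poly R} => 'X^2 * (p - p^`())) 1) (1 - e * (x - c)).

(* The factor [expR 1] compensates [flat 1 1 = expR (- 1)], so that the jump at
   [c] is [d]. *)
Definition spike c d e := spike_deriv c d e 0.

Lemma spike_bounded c d e : exists M, forall x, `|spike c d e x| <= M.
Proof.
have [C C0 fC] := flat_bounded (1 : {poly R}).
exists (`|d * expR 1| * C) => x; rewrite /spike /spike_deriv expr0 mulr1.
case: ifPn => _; first by rewrite normr0 mulr_ge0.
by rewrite normrM ler_wpM2l.
Qed.

Lemma spike_smooth X c d e : smooth_off_cutoff X c (spike c d e).
Proof.
exists (spike_deriv c d e) => // j x _ xc; apply: is_derive_within.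
have [xltc|cltx|xeqc] := ltgtP x c; last by rewrite xeqc eqxx in xc.
  apply: (@near_eq_is_derive R R R (cst 0)).
    by near=> y; rewrite /spike_deriv ifT//; near: y; exact: lt_nbhsl.
  by rewrite /spike_deriv xltc; exact: is_derive_cst.
set p := iter j (fun p : {poly R} => 'X^2 * (p - p^`())) 1.
apply: (@near_eq_is_derive R R R (fun y : R =>
    d * expR 1 * (- e) ^+ j * flat p (1 - e * (y - c)))).
  near=> y; rewrite /spike_deriv ifF//; apply/negbTE; rewrite -leNgt.
  by near: y; exact: lt_le_nbhsr.
have dN : is_derive x 1 (fun y : R => 1 - e * (y - c)) (- e).
  apply: is_derive_eq; rewrite /GRing.scale/=.
 by rewrite add0r mul1r subr0 mulr1.
have df := @is_derive1_comp _ _ _ _ _ _ (is_derive_flat p _) dN.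
rewrite /comp in df.
apply: is_derive_eq; rewrite /spike_deriv ifF; last by rewrite ltNge ltW.
by rewrite /= -/p (exprSr (- e)) /GRing.scale/=; ring.
Unshelve. all: by end_near. Qed.

Lemma spike_eq0 c d e x : x < c \/ 1 <= e * (x - c) -> spike c d e x = 0.
Proof.
rewrite /spike /spike_deriv => -[->//|ex]; case: ifPn => // _.
by rewrite /flat ltNge subr_le0 ex/= mulr0.
Qed.

Lemma spike_left c d e : spike c d e x @[x --> c^'-] --> (0 : R).
Proof.
apply: cvg_near_cst; near=> x; apply: spike_eq0; left.
by near: x; exact: nbhs_left_lt.
Unshelve. all: by end_near. Qed.

Lemma spike_right c d e : spike c d e x @[x --> c^'+] --> d.
Proof.
have dE : d * expR 1 * flat 1 (1 - e * (c - c)) = d.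
  rewrite subrr mulr0 subr0 /flat ltr01 invr1 hornerC mul1r -mulrA -expRD.
  by rewrite subrr expR0 mulr1.
(* Without the case split the formula is continuous on the whole line, so its right limit at [c] is
   its value there. *)
have ct : continuous (fun x : R => d * expR 1 * flat 1 (1 - e * (x - c))).
  move=> x; apply: cvgM; first exact: cvg_cst.
  apply: (@continuous_comp _ _ _ (fun x : R => 1 - e * (x - c))).
    apply: cvgB; first exact: cvg_cst.
    apply: cvgM; first exact: cvg_cst.
    by apply: cvgB; [exact: cvg_id|exact: cvg_cst].
  exact: flat_continuous.
have := cvg_at_right_filter (ct c); rewrite dE.
apply: cvg_trans; apply: near_eq_cvg.
near=> x; rewrite /spike /spike_deriv/= ifF.
  by rewrite expr0 mulr1.
by apply/negbTE; rewrite -leNgt; near: x; exact: nbhs_right_ge.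
Unshelve. all: by end_near. Qed.

Lemma measurable_spike c d e : measurable_fun setT (spike c d e).
Proof.
apply: measurable_fun_ifT => //.
  by apply: measurable_fun_ltr.
apply: measurable_funM => //; apply: (measurableT_comp (f := flat _)).
  by apply: continuous_measurable_fun; exact: flat_continuous.
by apply: measurable_funB => //; apply: measurable_funM => //; exact: measurable_funB.
Qed.

End spike.

(** * Images and null sets of product powers *)

Section product_power_pushforward.
Context d (T : measurableType d) (R : realType).

Lemma measurable_map_tuple d' (T' : measurableType d') n (f : T -> T') :
  measurable_fun setT f -> measurable_fun setT (fun z : n.-tuple T => map_tuple f z).
Proof.
move=> mf; apply/measurable_fun_tnthP => i.
have -> : @tnth n T' ^~ i \o (fun z : n.-tuple T => map_tuple f z) =
    f \o @tnth n T ^~ i by apply/funext => z /=; rewrite tnth_map.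
by apply: measurableT_comp => //; exact: measurable_tnth.
Qed.

(** By induction: the product measure integrates the measures of sections; a change of variables
    handles the first coordinate and the induction hypothesis handles the sections. *)
Lemma product_power_distribution (P : probability T R) (f : {mfun T >-> T}) n A :
  measurable A ->
  product_power (distribution P f) n A =
  product_power P n ((fun z => map_tuple f z) @^-1` A).
Proof.
elim: n A => [|n IH] A mA.
  rewrite /= !diracE; congr (_%:R%:E); congr (nat_of_bool _).
  apply/idP/idP; rewrite !inE/=; congr A; exact/val_inj.
have mB : measurable (@cons_pair _ _ n @^-1` A).
  by rewrite -[X in measurable X]setTI; exact: measurable_cons_pair.
rewrite /= /pushforward /product_measure1 ge0_integral_pushforward//=; last first.
  exact: measurable_fun_xsection.
apply: eq_integral => x _ /=.
rewrite IH; last exact: measurable_xsection.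
congr (product_power P n _); apply/seteqP; split => z; rewrite /xsection/= !inE/=.
  by congr A; apply/val_inj.
by congr A; apply/val_inj.
Qed.

(** The event is a finite union of cylinders, one per coordinate, and each cylinder is a box with
    one null side. *)
Lemma negligible_product_power (P : probability T R) n (N : set T) :
  P.-negligible N ->
  (product_power P n).-negligible [set z | exists i, N (tnth z i)].
Proof.
move=> [M [mM PM NM]].
have mMi i : measurable ((@tnth n T ^~ i) @^-1` M).
  by rewrite -[X in measurable X]setTI; exact: measurable_tnth.
apply: (@negligibleS _ _ _ _ (\big[setU/set0]_(i < n) ((@tnth n T ^~ i) @^-1` M))).
  move=> z [i Ni]; rewrite -bigcup_seq/=; exists i; last exact: NM.
  by rewrite /= mem_index_enum.
elim/big_ind : _ => [|A B|i _]; first exact: negligible_set0.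
  exact: negligibleU.
exists ((@tnth n T ^~ i) @^-1` M); split => //.
pose A j := if j == i then M else setT.
have -> : (@tnth n T ^~ i) @^-1` M = [set z | forall j, A j (tnth z j)].
  apply/seteqP; split => z /=; last by move=> /(_ i); rewrite /A eqxx.
  by move=> Mz j; rewrite /A; case: eqP => // ->.
have mA j : measurable (A j) by rewrite /A; case: ifP.
by apply: (eq_trans (product_powerE P mA)); rewrite (bigD1 i)//= /A eqxx PM mul0e.
Qed.

End product_power_pushforward.

(** * Convergence and measurability on the space of samples *)

Section tuple_space.

Lemma cvg_initial_topology {S : choiceType} {T : topologicalType} {I : Type}
    {F : set_system I} {FF : Filter F} (f : S -> T) (u : I -> S) (s : S) :
  f (u k) @[k --> F] --> f s ->
  u k @[k --> F] --> (s : initial_topology f).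
Proof.
move=> us A; rewrite nbhsE => -[_ [[B oB <-] Bs] BA].
apply: (@filterS _ F FF _ _ _ (us B (open_nbhs_nbhs (conj oB Bs)))) => k.
exact: BA.
Qed.

(** The topology of tuples is initial for [tnth], and the pointwise topology is the supremum of the
    initial topologies of the evaluations; [cvg_initial_topology] is used once for each layer. *)
Lemma cvg_tuple {T : topologicalType} {I : Type} {F : set_system I} {FF : Filter F}
    n (u : I -> n.-tuple T) (z : n.-tuple T) :
  (forall i, tnth (u k) i @[k --> F] --> tnth z i) -> u k @[k --> F] --> z.
Proof.
move=> uz; apply: (@cvg_initial_topology _ {ptws 'I_n -> T}).
have FN : Filter (tnth (u k) @[k --> F]) by exact: fmap_filter.
apply: (iffRL (@cvg_sup _ 'I_n (fun i => Topological.class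
  (initial_topology (fun f : (forall i : 'I_n, T) => f i))) _ (tnth z) FN)) => i.
by apply: cvg_initial_topology; exact: uz.
Qed.

Context {R : realType}.

Let rnd j (p : R * R) : int * int :=
  (Num.floor (p.1 * j.+1%:R), Num.floor (p.2 * j.+1%:R)).

Let unrnd j (q : int * int) : R * R := (q.1%:~R / j.+1%:R, q.2%:~R / j.+1%:R).

Let floor_cvg (x : R) : (Num.floor (x * j.+1%:R))%:~R / j.+1%:R @[j --> \oo] --> x.
Proof.
apply: (@squeeze_cvgr _ _ _ _ (fun j => x - j.+1%:R^-1) (fun=> x)); last 2 first.
- rewrite -[X in _ --> X]subr0; apply: cvgB; first exact: cvg_cst.
  exact: cvg_harmonic.
- exact: cvg_cst.
near=> j.
rewrite ler_pdivlMr// ler_pdivrMr// floor_le andbT mulrBl mulVf ?pnatr_eq0//.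
by rewrite lerBlDr ltW// -[1]/(1%:~R) -intrD floorD1_gt.
Unshelve. all: by end_near. Qed.

(* A continuous function is the pointwise limit of its compositions with
   rounding to the grids [(j+1)^-1 Z], which take countably many values. *)
Lemma continuous_measurable_tuple n (h : n.-tuple (R * R)%type -> R) :
  continuous h -> measurable_fun setT h.
Proof.
move=> ch.
pose q j (z : n.-tuple (R * R)%type) := map_tuple (rnd j) z.
pose r j (k : n.-tuple (int * int)) := map_tuple (unrnd j) k.
apply: (@measurable_fun_cvg _ _ _ setT (fun j z => h (r j (q j z)))); last first.
  move=> z _; have rqz : r j (q j z) @[j --> \oo] --> z.
    apply: cvg_tuple => i; under eq_fun do rewrite !tnth_map.
    case: (tnth z i) => a b.
    exact: cvg_pair (@floor_cvg a) (@floor_cvg b).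
  exact: cvg_comp rqz (ch z).
move=> j _ B mB; rewrite setTI.
(* The rounded function is constant on each grid cell, so the preimage is a countable union of
   cells; each cell is a box of half-open intervals. *)
have -> : (fun z => h (r j (q j z))) @^-1` B =
   \bigcup_k (q j @^-1` [set k] `&` [set _ | B (h (r j k))]).
  apply/seteqP; split => [z Bz|z [k _ /= [<-//]]].
  by exists (q j z).
apply: countable_bigcupT_measurable => [|k]; first exact: countableP.
have [Bk|Bk] := pselect (B (h (r j k))); last first.
  by rewrite (_ : _ `&` _ = set0)//; apply/seteqP; split => // z [].
rewrite (_ : _ `&` _ = q j @^-1` [set k]); last first.
  by apply/seteqP; split => // z [].
have -> : q j @^-1` [set k] = \bigcap_(i in [set: 'I_n])
    (@tnth _ (R * R)%type ^~ i) @^-1` (rnd j @^-1` [set tnth k i]).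
  apply/seteqP; split => [z /= <- i _|z zk /=]; first by rewrite /= tnth_map.
  by apply: eq_from_tnth => i; rewrite tnth_map; exact: zk.
apply: fin_bigcap_measurable => // i _.
rewrite -[X in measurable X]setTI; apply: measurable_tnth => //.
case: (tnth k i) => a b.
have -> : rnd j @^-1` [set (a, b)] =
    ((fun x : R => Num.floor (x * j.+1%:R)) @^-1` [set a]) `*`
    ((fun x : R => Num.floor (x * j.+1%:R)) @^-1` [set b]).
  by apply/seteqP; split => -[x y] /= [<- <-].
suff mf c : measurable ((fun x : R => Num.floor (x * j.+1%:R)) @^-1` [set c]).
  exact: measurableX.
have -> : (fun x : R => Num.floor (x * j.+1%:R)) @^-1` [set c] =
    `[c%:~R / j.+1%:R, (c + 1)%:~R / j.+1%:R[%classic.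
  apply/seteqP; split => x /=.
    by move=> <-; rewrite in_itv/= ler_pdivrMr// ltr_pdivlMr// floor_itv.
  by rewrite in_itv/= ler_pdivrMr// ltr_pdivlMr// => /floor_def.
exact: measurable_itv.
Qed.

End tuple_space.

(** * Uniqueness of the regression function away from the cutoff *)

Lemma integral_gt0_near {R : realType} (f : R -> R) (D : set R) (x : R) :
  measurable D -> measurable_fun D f -> (forall y, D y -> 0 <= f y) ->
  nbhs x D -> f y @[y --> x] --> f x -> 0 < f x ->
  (0 < \int[lebesgue_measure]_(y in D) (f y)%:E)%E.
Proof.
move=> mD mf f0 Dx fx fx0.
(* On a small ball the integrand exceeds half its value at the centre, and the ball has positive
   length. *)
have : \forall y \near x, D y /\ f x / 2 < f y.
  near=> y; split; near: y => //.
  by apply: (cvgr_gt _ fx); rewrite ltr_pdivrMr// ltr_pMr// ltr1n.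
move=> /nbhs_ballP [r /= r0 rD].
have mb : measurable (ball x r) by exact: measurable_ball.
have bD : ball x r `<=` D by move=> y /rD [].
apply: (@lt_le_trans _ _ (\int[lebesgue_measure]_(y in ball x r) (f x / 2)%:E)%E).
  have ball_gt0 : (0 < lebesgue_measure (ball x r))%E.
    by rewrite lebesgue_measure_ball ?ltW// lte_fin mulrn_wgt0.
  by rewrite integral_cst//; apply: mule_gt0 => //; rewrite lte_fin divr_gt0.
apply: (@le_trans _ _ (\int[lebesgue_measure]_(y in ball x r) (f y)%:E)%E).
  apply: ge0_le_integral => //.
  - by move=> y _; rewrite lee_fin divr_ge0// ltW.
  - by apply/measurable_EFinP; exact: measurable_funS bD mf.
  - by move=> y /rD [_ /ltW]; rewrite lee_fin.
by apply: ge0_subset_integral => //; exact/measurable_EFinP.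
Unshelve. all: by end_near. Qed.

Section regression_versions.
Context {R : realType} {X : set R} {c : R}.
Hypothesis mX : measurable X.
Implicit Types (g : R -> R) (P : probability (R * R)%type R) (A : set R).

Lemma measurable_fst_preimage A :
  measurable A -> measurable ((fst : R * R -> R) @^-1` A).
Proof. by move=> mA; rewrite -[X in measurable X]setTI; exact: measurable_fst. Qed.

(** The increment of [g] is the difference quotient, which converges, times y - x, which tends to
    0. *)
Lemma smooth_off_cutoff_cvg g x : smooth_off_cutoff X c g -> X x -> x != c ->
  g y @[y --> within X (nbhs x)] --> g x.
Proof.
move=> [G G0 dG] Xx xc; have := dG 0%N x Xx xc; rewrite /derivative_within G0.
set q := fun y : R => (g y - g x) / (y - x) => ql.
have sub0 : (y - x) @[y --> within X x^'] --> (0 : R).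
  rewrite -(subrr x); apply: cvgB; last exact: cvg_cst.
  apply: cvg_trans (@cvg_id _ (nbhs x)).
  by apply: cvg_trans (cvg_within _) _; exact: cvg_within.
have : (q y * (y - x)) @[y --> within X x^'] --> (0 : R).
  by rewrite -(mulr0 (G 1%N x)); exact: cvgM.
move=> /cvgr0Pnorm_lt qx; apply/cvgrPdist_lt => e e0.
have := qx e e0; rewrite !near_withinE.
apply: filterS => y /= h Xy; rewrite distrC.
have [->|yx] := eqVneq y x; first by rewrite subrr normr0.
by have := h yx Xy; rewrite /q divfK// subr_eq0.
Qed.

(** [g] is continuous on [X] without [c], and any function is measurable on the singleton left
    over. *)
Lemma measurable_smooth_off_cutoff g :
  smooth_off_cutoff X c g -> measurable_fun X g.
Proof.
move=> sg; have mXc : measurable (X `\ c) by exact: measurableD.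
have mg : measurable_fun (X `\ c) g.
  apply: subspace_continuous_measurable_fun => //.
  apply/subspace_continuousP => x [Xx /= xc].
  apply: cvg_trans (smooth_off_cutoff_cvg sg Xx _); last exact/eqP.
  apply: cvg_app => B.
  by apply: (@filterS _ (nbhs x) _ (fun y => X y -> B y)) => y + [Xy _]; apply.
have : measurable_fun (X `\ c `|` [set c]) g.
  by apply/(measurable_funU _ mXc (measurable_set1 c)); split => //; exact: measurable_fun_set1.
apply: measurable_funS; first exact: measurableU.
by move=> x Xx; have [->|/eqP] := eqVneq x c; [right|left].
Qed.

Lemma integrable_regression P g A : regression_function X c g ->
  measurable A -> A `<=` X ->
  P.-integrable (fst @^-1` A) (fun z => (g z.1)%:E).
Proof.
move=> [[M gM] sg _ _] mA AX.
apply: (@measurable_bounded_integrable _ _ _ _ (g \o fst)).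
- exact: measurable_fst_preimage.
- by rewrite (le_lt_trans (probability_le1 _ _)) ?ltry//; exact: measurable_fst_preimage.
- apply: (@measurable_comp _ _ _ _ _ _ X) => //; first by move=> _ [z /AX ? <-].
    exact: measurable_smooth_off_cutoff.
  exact: measurable_funTS.
- exists M; split; first exact: num_real.
  by move=> N MN z Az /=; rewrite (le_trans (gM _ _)) ?(ltW MN)//; exact: AX.
Qed.

(** As the support is the closure of [X], the open set [A] contains a point where the density is
    nonzero, and continuity keeps it positive nearby. *)
Lemma continuous_density_gt0 P f A : continuous_density X P f ->
  open A -> A `<=` X -> A !=set0 -> (0 < P (fst @^-1` A))%E.
Proof.
move=> [cf f0 _ supp Pf] oA AX [x Ax].
have : closure [set x | f x != 0] x by rewrite supp; apply: subset_closure; exact: AX.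
move=> /(_ A (open_nbhs_nbhs (conj oA Ax))) [x0 [/= fx0 Ax0]].
have Xx0 : X° x0 by apply: filterS AX _; exact: open_nbhs_nbhs.
have fx0_gt0 : 0 < f x0 by rewrite lt0r fx0 f0.
have cfx0 : f y @[y --> x0] --> f x0.
  have /subspace_continuousP/(_ x0 (interior_subset Xx0)) := cf.
  by rewrite within_interior.
rewrite Pf; last exact: open_measurable.
apply: (@integral_gt0_near _ _ _ x0) => //; first exact: open_measurable.
  by apply: measurable_funS AX _ => //; exact: subspace_continuous_measurable_fun.
exact: open_nbhs_nbhs.
Qed.

(** Both versions integrate over the event {X in A} to the same number, the integral of Y. The
    bounds then give r2 p <= r1 p for the probability p of that event, which forces p = 0. *)
Lemma regression_version_gap P g1 g2 A r1 r2 :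
  regression_version X c P g1 -> regression_version X c P g2 ->
  measurable A -> A `<=` X -> r1 < r2 ->
  (forall x, A x -> g1 x <= r1 /\ r2 <= g2 x) -> P (fst @^-1` A) = 0%E.
Proof.
move=> [rg1 [_ Eg1]] [rg2 [_ Eg2]] mA AX r12 gr.
have mfA := measurable_fst_preimage mA.
have Pfin : P (fst @^-1` A) \is a fin_num by exact: fin_num_measure.
have icst r : P.-integrable (fst @^-1` A) (EFin \o cst r).
  exact: finite_measure_integrable_cst.
have : (r2%:E * P (fst @^-1` A) <= r1%:E * P (fst @^-1` A))%E.
  rewrite -!integral_cst//.
  apply: (@le_trans _ _ (\int[P]_(z in fst @^-1` A) (g2 z.1)%:E)%E).
    apply: le_integral => //; first exact: icst.
      exact: integrable_regression.
    by move=> z; rewrite inE lee_fin => /gr [].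
  rewrite -Eg2// Eg1//; apply: le_integral => //.
  - exact: integrable_regression.
  - exact: icst.
  - by move=> z; rewrite inE lee_fin => /gr [].
rewrite -(fineK Pfin) -!EFinM lee_fin; set p := fine _ => h.
have p0 : 0 <= p by exact/fine_ge0/measure_ge0.
congr (_%:E); nra.
Qed.

(** If two versions differed at x, continuity would keep them apart on an open neighbourhood, which
    is null by [regression_version_gap] and yet has positive mass under the density. *)
Lemma regression_version_eq P f g1 g2 x : continuous_density X P f ->
  regression_version X c P g1 -> regression_version X c P g2 ->
  X° x -> x != c -> g1 x = g2 x.
Proof.
move=> Pf vg1 vg2 Xx xc; apply/eqP.
wlog : g1 g2 vg1 vg2 / g1 x <= g2 x.
  by move=> wl; have [/wl|/ltW/wl h] := leP (g1 x) (g2 x);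
    [exact|rewrite eq_sym; exact: h].
rewrite le_eqVlt => /predU1P[->//|g12]; exfalso.
have gx g : regression_version X c P g -> g y @[y --> x] --> g x.
  move=> [[_ sg _ _] _]; rewrite -{1}(within_interior Xx).
  by apply: smooth_off_cutoff_cvg => //; exact: interior_subset.
pose r1 := g1 x + (g2 x - g1 x) / 3; pose r2 := g1 x + (g2 x - g1 x) * 2 / 3.
have : \forall y \near x, [/\ X y, g1 y <= r1 & r2 <= g2 y].
  near=> y; split; near: y; first exact: Xx.
    by apply: (cvgr_le _ (gx _ vg1)); rewrite /r1; lra.
  by apply: (cvgr_ge _ (gx _ vg2)); rewrite /r2; lra.
rewrite /prop_near1 nbhsE => -[B [oB Bx] Bgr].
have BX : B `<=` X by move=> y /Bgr [].
have := continuous_density_gt0 Pf oB BX (ex_intro _ x Bx).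
rewrite (regression_version_gap vg1 vg2 (r1 := r1) (r2 := r2)) ?ltxx//.
- exact: open_measurable.
- by rewrite /r1 /r2; lra.
- by move=> y /Bgr [].
Unshelve. all: by end_near. Qed.

(** [rdd_mu] evaluates an arbitrarily chosen version, but the one-sided limits only see points near
    [c] and different from it, where all versions agree. *)
Lemma rdd_muE P f g : X° c -> continuous_density X P f ->
  regression_version X c P g -> rdd_mu X c P = jump c g.
Proof.
move=> Xc Pf vg; rewrite /rdd_mu; set g' := xget _ _.
have vg' : regression_version X c P g' by apply: xgetPex; exists g.
have eqg : \forall y \near c, y != c -> g' y = g y.
  apply: (@filterS _ (nbhs c) _ X°); last exact: nbhs_interior.
  by move=> y Xy yc; exact: regression_version_eq Pf vg' vg Xy yc.
have [[_ _ gl gr] _] := vg.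
rewrite /jump; congr (_ - _); apply: cvg_lim => //.
  apply: cvg_trans gr; apply: near_eq_cvg; near=> y; apply/esym.
  have yc : y != c by near: y; exact: nbhs_right_neq.
  by move: yc; near: y; apply: cvg_within.
apply: cvg_trans gl; apply: near_eq_cvg; near=> y; apply/esym.
have yc : y != c by near: y; exact: nbhs_left_neq.
by move: yc; near: y; apply: cvg_within.
Unshelve. all: by end_near. Qed.

End regression_versions.

(** * Moving a model into the null class by a vanishing perturbation *)

Section tilt.
Context {R : realType}.
Implicit Types (X : set R) (c d e : R) (Q : probability (R * R)%type R).

Definition tilt c d e (p : R * R) : R * R := (p.1, p.2 + spike c d e p.1).

Lemma measurable_tilt c d e : measurable_fun setT (tilt c d e).
Proof.
apply/measurable_fun_pairP; split => /=; first exact: measurable_fst.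
apply: measurable_funD; first exact: measurable_snd.
apply: (measurableT_comp (f := spike c d e)); last exact: measurable_fst.
exact: measurable_spike.
Qed.

HB.instance Definition _ c d e :=
  isMeasurableFun.Build _ _ _ _ (tilt c d e) (measurable_tilt c d e).

Lemma continuous_density_tilt X Q f c d e : continuous_density X Q f ->
  continuous_density X (distribution Q (tilt c d e)) f.
Proof. by move=> [*]; split. Qed.

(** Adding a bounded function of X to Y adds the same function to the conditional mean. Integrals
    under the new law are pulled back along [tilt] and split by linearity. *)
Lemma regression_version_tilt X Q c d e g : measurable X ->
  regression_version X c Q g ->
  regression_version X c (distribution Q (tilt c d e))
    (fun x => g x + spike c d e x).
Proof.
move=> mX [rg [Qy Qg]]; have [[M gM] [G G0 dG] gl gr] := rg.
have [N sN] := spike_bounded c d e.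
have [S S0 dS] := spike_smooth X c d e.
have rgs : regression_function X c (fun x => g x + spike c d e x).
  split.
  - by exists (M + N) => x Xx; rewrite (le_trans (ler_normD _ _))// lerD// gM.
  - exists (fun k x => G k x + S k x); first by rewrite G0 S0.
    move=> k x Xx xc.
    rewrite /derivative_within (_ : (fun y => _ / _) =
      fun y => (G k y - G k x) / (y - x) + (S k y - S k x) / (y - x)).
      exact: cvgD (dG k x Xx xc) (dS k x Xx xc).
    by apply/funext => y; rewrite -mulrDl addrACA -opprD.
  - by apply/cvg_ex; exists (lim (g x @[x --> c^'-]) + 0);
    exact: cvgD gl (@spike_left _ c d e).
  - by apply/cvg_ex; exists (lim (g x @[x --> c^'+]) + d);
    exact: cvgD gr (@spike_right _ c d e).
have isp : Q.-integrable setT (fun z => (spike c d e z.1)%:E).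
  apply: (@measurable_bounded_integrable _ _ _ _ (spike c d e \o fst)) => //.
  - by rewrite -ge0_fin_numE ?measure_ge0//; exact: fin_num_measure.
  - apply: (measurableT_comp (f := spike c d e)); last exact: measurable_fst.
    exact: measurable_spike.
  - exists N; split; first exact: num_real.
    by move=> N' NN' z _ /=; rewrite (le_trans (sN _)) ?(ltW NN').
have iys : Q.-integrable setT (fun z => (z.2 + spike c d e z.1)%:E).
  by under eq_fun do rewrite EFinD; exact: integrableD.
split=> //; split.
  apply: integrable_pushforward => //.
  by apply/measurable_EFinP; exact: measurable_snd.
move=> A mA AX; have mfA := measurable_fst_preimage mA.
rewrite integral_pushforward//=; first last.
- exact: (integrableS measurableT mfA _ iys).
- by apply/measurable_EFinP; exact: measurable_snd.
rewrite [LHS](_ : _ =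
    \int[Q]_(z in fst @^-1` A) (z.2%:E + (spike c d e z.1)%:E))%E//.
have ispA := integrableS measurableT mfA (@subsetT _ _) isp.
have igA := integrable_regression mX Q rg mA AX.
rewrite integralD//; last exact: (integrableS measurableT mfA _ Qy).
rewrite Qg// -integralD//.
(* [g] is known to be measurable on [X] only; extending the sum by 0 outside [A] gives a globally
   measurable function for the change of variables. *)
pose gs := (fun x => g x + spike c d e x) \_ A.
have mgs : measurable_fun setT gs.
  apply/(measurable_restrictT _ mA).
  apply: (measurable_funS mX AX).
  by apply: (measurable_smooth_off_cutoff (c := c) mX); case: rgs.
rewrite [RHS](_ : _ = (\int[distribution Q (tilt c d e)]_(z in fst @^-1` A)
    (gs z.1)%:E)%E); last first.
  by apply: eq_integral => z /[!inE] Az; rewrite /gs patchE mem_set.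
rewrite integral_pushforward//=; first last.
- apply: (eq_integrable _ (fun z => (g z.1)%:E + (spike c d e z.1)%:E)%E) => //.
    by move=> z /[!inE] Az; rewrite /= /gs patchE mem_set.
  exact: integrableD.
- by apply/measurable_EFinP; apply: measurableT_comp.
by apply: eq_integral => z /[!inE] Az; rewrite /= /gs patchE mem_set.
Qed.

(** The jump to be added is [m - jump c g] whatever the steepness [e]. Choosing [d] before [e] lets
    the steepness grow while [d] stays fixed. *)
Lemma rdd_null_tilt X c Q m : measurable X -> X° c -> rdd_model X c Q ->
  exists d, forall e, rdd_null X c m (distribution Q (tilt c d e)).
Proof.
move=> mX Xc [[f Qf] [g Qg]]; exists (m - jump c g) => e; set d := m - _.
have Pf := continuous_density_tilt c d e Qf.
have Pg := regression_version_tilt d e mX Qg.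
split; first by split; [exists f|exists (fun x => g x + spike c d e x)].
rewrite (rdd_muE mX Xc Pf Pg) /jump.
have [[_ _ gl gr] _] := Qg.
rewrite (cvg_lim _ (cvgD gr (@spike_right _ c d e)))//.
rewrite (cvg_lim _ (cvgD gl (@spike_left _ c d e)))//.
by rewrite addr0 addrAC -/(jump c g) /d addrC subrK.
Qed.

(** Points left of [c] never move, and a point x > c is fixed as soon as 1/(k+1) <= x - c. *)
Lemma near_tilt_id c d (p : R * R) : p.1 <> c ->
  \forall k \near \oo, tilt c d k.+1%:R p = p.
Proof.
case: p => x y /= /eqP xc; near=> k; rewrite /tilt/= spike_eq0 ?addr0//.
have [xltc|cltx|xeqc] := ltgtP x c; [by left| |by rewrite xeqc eqxx in xc].
right; rewrite -ler_pdivrMr ?subr_gt0// mul1r.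
rewrite (@le_trans _ _ k%:R) ?ler_nat//.
by near: k; exact: nbhs_infty_ger.
Unshelve. all: by end_near. Qed.

(* Off [X = c] the samples moved by [tilt] are eventually equal to the original
   ones, so that no continuity of [phi] is needed. *)
Lemma cvg_expectation_tilt X c d Q n (phi : n.-tuple (R * R)%type -> R) M :
  rdd_model X c Q -> measurable_fun setT phi -> (forall z, `|phi z| <= M) ->
  ('E_(product_power (distribution Q (tilt c d k.+1%:R)) n)[phi] @[k --> \oo]
    --> 'E_(product_power Q n)[phi])%E.
Proof.
move=> [[f [_ _ _ _ Qf]] _] mphi phiM.
pose T k (z : n.-tuple (R * R)%type) := map_tuple (tilt c d k.+1%:R) z.
have mT k : measurable_fun setT (T k).
  by apply: measurable_map_tuple; exact: measurable_tilt.
rewrite unlock.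
rewrite [X in X @ _ --> _](_ : _ =
    fun k => \int[product_power Q n]_z (phi (T k z))%:E)%E; last first.
  apply/funext => k.
  rewrite (@eq_measure_integral _ _ _ _ (pushforward (product_power Q n) (T k))).
    rewrite integral_pushforward//; first exact/measurable_EFinP.
    rewrite preimage_setT.
    apply: (@measurable_bounded_integrable _ _ _ _ (phi \o T k)) => //.
    - by rewrite -ge0_fin_numE ?measure_ge0//; exact: fin_num_measure.
    - exact: measurableT_comp.
    - exists M; split; first exact: num_real.
      by move=> N MN z _ /=; rewrite (le_trans (phiM _)) ?(ltW MN).
  by move=> A mA _; exact: product_power_distribution.
(* X has a density, so samples with an observation exactly at [c] form a null set. *)
have Nc : (product_power Q n).-negligible
    [set z | exists i, (fst @^-1` [set c]) (tnth z i)].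
  apply: negligible_product_power.
  exists (fst @^-1` [set c]); split => //; first exact: measurable_fst_preimage.
  by rewrite Qf// integral_set1.
have [] := @dominated_convergence _ _ _ (product_power Q n) setT measurableT
  (fun k z => (phi (T k z))%:E) (fun z => (phi z)%:E) (cst M%:E) => //.
- by move=> k; apply/measurable_EFinP; exact: measurableT_comp.
- exact/measurable_EFinP.
- apply: negligibleS Nc => z /=; apply: contra_notP => /forallNP zc _.
  apply: cvg_near_cst.
  (* There are finitely many observations, so one threshold on k serves them all and the integrand
     becomes constant in k. *)
  have : \forall k \near \oo, forall i, tilt c d k.+1%:R (tnth z i) = tnth z i.
    by apply: filter_forall => i; exact: near_tilt_id.
  apply: filterS => k Tz; congr (phi _)%:E.
  by apply: eq_from_tnth => i; rewrite tnth_map.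
- exact: finite_measure_integrable_cst.
- by apply: aeW => z k _; rewrite lee_fin.
Qed.

End tilt.

(** * Nonemptiness of the model *)

Lemma conditional_probability_ex d (T : measurableType d) (R : realType)
    (P : probability T R) (D : set T) : measurable D -> (0 < P D)%E ->
  exists Q : probability T R,
    forall A, Q A = (P (A `&` D) * (fine (P D))^-1%:E)%E.
Proof.
move=> mD PD; exists (mnormalize (mrestr P mD) P) => A.
(* [mnormalize] falls back to a default measure when the total mass is 0 or infinite; both cases are
   excluded here. *)
rewrite /= /mnormalize /= /mrestr setTI ifF//.
by rewrite gt_eqF//=; apply/negbTE; rewrite -ltey ltey_eq fin_num_measure.
Qed.

Lemma pushforward_probability_ex d d' (T : measurableType d)
    (T' : measurableType d') (R : realType) (P : probability T R) (f : T -> T') :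
  measurable_fun setT f ->
  exists Q : probability T' R, forall A, Q A = P (f @^-1` A).
Proof.
by move=> mf; exists (distribution P (mfun_Sub (mem_set mf))) => A.
Qed.

Section model_nonempty.
Context {R : realType} {X : set R} {c : R}.

(** The witness is a standard normal covariate conditioned to lie in [X], with outcome identically
    0. The infimum of coverage over an empty model would be +oo. *)
Lemma rdd_model_nonempty : measurable X -> X° c -> exists P, rdd_model X c P.
Proof.
move=> mX Xc; 
have [N NE] : exists N : probability R R, forall A, N A = normal_prob 0 1 A.
  exact: (@pushforward_probability_ex _ _ _ R R (normal_prob 0 1) id).
have pdf_ge0 x : 0 <= normal_pdf (0 : R) 1 x by exact: normal_pdf_ge0.
have pdf_gt0 x : 0 < normal_pdf (0 : R) 1 x.
  by rewrite normal_pdfE ?oner_neq0// mulr_gt0 ?normal_peak_gt0 ?oner_neq0// expR_gt0.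
have pdf_cont : continuous (normal_pdf (0 : R) 1).
  by apply: continuous_normal_pdf; rewrite oner_neq0.
(* [c] is interior to [X] and the normal density is positive there. *)
have NX0 : (0 < N X)%E.
  rewrite NE.
  apply: (@integral_gt0_near _ _ _ c) => //; last exact: pdf_cont.
  by apply: measurable_funTS; exact: measurable_normal_pdf.
have NXfin : N X \is a fin_num by exact: fin_num_measure.
have [M MN] := conditional_probability_ex mX NX0.
have ME A : measurable A -> M A = (\int[lebesgue_measure]_(x in A `&` X)
    (normal_pdf 0 1 x / fine (N X))%:E)%E.
  move=> mA; have mAX : measurable (A `&` X) by exact: measurableI.
  have mpdf : measurable_fun (A `&` X) (fun x : R => (normal_pdf 0 1 x)%:E).
    by apply/measurable_EFinP; apply: measurable_funTS; exact: measurable_normal_pdf.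
  rewrite MN [N (A `&` X)]NE.
  under eq_integral do rewrite EFinM.
  rewrite ge0_integralZr//.
  - by move=> x _; rewrite lee_fin.
  - by rewrite lee_fin invr_ge0 fine_ge0// ltW.
pose T : {mfun R >-> (R * R)%type} := mfun_Sub (mem_set (pair2_measurable (0 : R))).
pose f := (fun x => normal_pdf 0 1 x / fine (N X)) \_ X.
have p_gt0 : 0 < fine (N X) by rewrite fine_gt0// NX0 ltey_eq NXfin.
exists (distribution M T); split.
  exists f; split.
  - have : {within X, continuous (fun x => normal_pdf 0 1 x / fine (N X))}.
      apply: continuous_subspaceT => x; apply: cvgM; last exact: cvg_cst.
      exact: pdf_cont.
    apply: subspace_eq_continuous.
    by move=> x Xx; rewrite /from_subspace /f patchE Xx.
  - move=> x; rewrite /f patchE; case: ifP => // _.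
    by rewrite divr_ge0// ltW.
  - by move=> x Xx; rewrite /f patchE memNset.
  - congr closure; apply/seteqP; split => x /=.
      by rewrite /f patchE; case: ifPn => [/set_mem//|_]; rewrite eqxx.
    by move=> Xx; rewrite /f patchE mem_set// mulf_neq0// ?invr_neq0 ?gt_eqF.
  - move=> A mA; rewrite /= /distribution /pushforward.
    rewrite [X in M X](_ : _ = A); last first.
      by apply/seteqP; split => x.
    rewrite ME// integral_mkcondr; apply: eq_integral => x _.
    by rewrite /f !patchE; case: ifP.
exists (cst 0); split.
  split.
  - by exists 0 => x _; rewrite normr0.
  - exists (fun _ => cst 0) => // k x _ _; rewrite /derivative_within.
    by under eq_fun do rewrite subrr mul0r; exact: cvg_cst.
  - exact: is_cvg_cst.
  - exact: is_cvg_cst.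
have msnd : measurable_fun setT (fun z : R * R => (z.2)%:E).
  by apply/measurable_EFinP; exact: measurable_snd.
have sndT : (fun z : R * R => (z.2)%:E) \o T = cst 0%E.
  by apply/funext => x.
have isndT D : M.-integrable (T @^-1` D) ((fun z : R * R => (z.2)%:E) \o T).
  by rewrite sndT; exact: integrable0.
split; first exact: integrable_pushforward.
move=> A mA AX; rewrite integral_pushforward//; last exact: measurable_fst_preimage.
by rewrite sndT /= !integral0.
Qed.

End model_nonempty.

(** * Expected length against uniform coverage *)

Section confidence_sets.
Context d (T : measurableType d) (R : realType).

Lemma set_length_ge (C : set R) (a b : R) :
  C a -> C b -> ((b - a)%:E <= set_length C)%E.
Proof.
move=> Ca Cb; rewrite /set_length ifF; last first.
  by apply/eqP => C0; move: Ca; rewrite C0.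
rewrite EFinB; apply: leeB.
  by apply: ereal_sup_ubound; exists b.
by apply: ereal_inf_lbound; exists a.
Qed.

Lemma set_length_ge0 (C : set R) : (0 <= set_length C)%E.
Proof.
have [->|/set0P[a Ca]] := eqVneq C set0; first by rewrite /set_length eqxx.
by have := set_length_ge Ca Ca; rewrite subrr.
Qed.

(* The values [j D] are more than a typical length apart, so that the events
   of covering them with a set shorter than [D] are disjoint. *)
Lemma coverage_not_bounded_below (mu : probability T R) (C : T -> set R) (b : R) :
  is_confidence_set C -> (\int[mu]_z set_length (C z) < +oo)%E -> 0 < b ->
  ~ forall m, (b%:E <= mu [set z | C z m])%E.
Proof.
move=> [mC mlen] len_fin b0 cov; have b20 : 0 < b / 2 by rewrite divr_gt0.
set I := (\int[mu]_z set_length (C z))%E in len_fin.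
have I0 : (0 <= I)%E by apply: integral_ge0 => z _; exact: set_length_ge0.
have Ifin : I \is a fin_num by rewrite ge0_fin_numE.
(* By Markov's inequality the length reaches [D] with probability at most b/2; adding 1 keeps [D]
   positive when the expected length is 0. *)
pose D := fine I / (b / 2) + 1.
have D0 : 0 < D by rewrite ltr_wpDl// divr_ge0 ?fine_ge0// ltW.
pose L := [set z | (D%:E <= set_length (C z))%E].
have mL : measurable L.
  rewrite -[X in measurable X]setTI; exact: emeasurable_fun_c_infty.
have muL : (mu L <= (b / 2)%:E)%E.
  have := @le_integral_comp_abse _ _ _ mu setT measurableT
    (fun z => set_length (C z)) D id (@measurable_id _ _ _) (fun r r0 => r0)
    (fun _ _ _ _ xy => xy) mlen D0.
  rewrite setTI /=.
  under [X in mu X]eq_set do rewrite gee0_abs ?set_length_ge0//.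
  under eq_integral do rewrite gee0_abs ?set_length_ge0//.
  rewrite -/L -/I -(fineK Ifin) -[mu L]fineK ?fin_num_measure// -EFinM !lee_fin => DL.
  rewrite -(ler_pM2l D0) (le_trans DL)//.
  by rewrite /D mulrDl divfK ?gt_eqF// mul1r lerDl ltW.
pose F (j : nat) := [set z | C z (j%:R * D)] `\` L.
have mF j : measurable (F j) by apply: measurableD => //; exact: mC.
have tF : trivIset setT F.
  apply: ltn_trivIset => j i ij; apply/seteqP; split => // z [[Ci Lz] [Cj _]].
  apply: Lz; rewrite /L/=; apply: le_trans (set_length_ge Ci Cj).
  rewrite lee_fin -mulrBl -natrB ?(ltnW ij)// ler_peMl ?(ltW D0)//.
  by rewrite ler1n subn_gt0.
(* Removing the long sets costs at most half of the coverage [b]. *)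
have muF j : ((b / 2)%:E <= mu (F j))%E.
  have FL : (mu [set z | C z (j%:R * D)%R] <= mu (F j) + mu L)%E.
    apply: le_trans (measureU2 _ _ _) => //; rewrite le_measure ?inE//.
      exact: measurableU.
    by move=> z Cz; have [|] := pselect (L z); [right|left].
  have := le_trans (cov (j%:R * D)) FL.
  rewrite -[mu (F j)]fineK ?fin_num_measure// -[mu L]fineK ?fin_num_measure//.
  move: muL; rewrite -[mu L]fineK ?fin_num_measure// -EFinD !lee_fin; lra.
have [N bN] : exists N : nat, 1 < N%:R * (b / 2).
  exists (Num.truncn (b / 2)^-1).+1.
  by rewrite -ltr_pdivrMr// mul1r truncnS_gt.
have : (\sum_(i < N) mu (F i) <= 1)%E.
  rewrite -(measure_bigsetU_ord mu xpredT)//; last first.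
    by move=> i j _ _ ij; apply/val_inj; exact: tF ij.
  by apply: probability_le1; apply: bigsetU_measurable => i _; exact: mF.
apply/negP; rewrite -ltNge; apply: (@lt_le_trans _ _ (\sum_(i < N) (b / 2)%:E)%E).
  by rewrite sumEFin lte_fin sumr_const card_ord -[_ *+ N]mulr_natl.
exact: lee_sum.
Qed.

End confidence_sets.

(** * Approximation, power of tests and coverage *)

Theorem corollary3 (R : realType) (X : set R) (c : R)
    (X_itv : is_interval X) (Xc : X° c) (n : nat) (n_gt0 : (0 < n)%N) :
  (forall (m : R) (Q : probability (R * R)%type R), rdd_alternative X c m Q ->
     exists nu_ : nat -> probability (n.-tuple (R * R)%type) R,
       (forall k, convex_hull
          [set product_power P n | P in rdd_null X c m] (nu_ k)) /\
       cvg_in_distribution nu_ (product_power Q n)) /\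
  (forall (m : R) (phi : n.-tuple (R * R)%type -> R), is_test phi ->
     (forall Q, rdd_alternative X c m Q ->
        as_continuous (product_power Q n) phi) ->
     (ereal_sup [set 'E_(product_power Q n)[phi] | Q in rdd_alternative X c m] <=
      ereal_sup [set 'E_(product_power P n)[phi] | P in rdd_null X c m])%E) /\
  (forall C : n.-tuple (R * R)%type -> set R, is_confidence_set C ->
     (forall P, rdd_model X c P ->
        (\int[product_power P n]_z set_length (C z) < +oo)%E) ->
     ereal_inf [set product_power P n [set z | C z (rdd_mu X c P)]
               | P in rdd_model X c] = 0%E).
Proof.
have mX : measurable X by exact: is_interval_measurable.
split; [move=> m Q [mQ _]|split; [move=> m phi [mphi phi01] _|move=> C confC finC]].
- have [d nullP] := rdd_null_tilt m mX Xc mQ.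
  exists (fun k => product_power (distribution Q (tilt c d k.+1%:R)) n); split.
    (* The mixture is trivial: one component of weight 1. *)
    move=> k; exists 1%N, (cst 1).
    exists (cst (product_power (distribution Q (tilt c d k.+1%:R)) n)).
    split => //; first by rewrite big_ord1.
      by move=> i; exists (distribution Q (tilt c d k.+1%:R)).
    by move=> A mA; rewrite big_ord1 mul1e.
  move=> h ch [M hM]; apply: (cvg_expectation_tilt d mQ _ hM).
  exact: continuous_measurable_tuple.
- apply: ge_ereal_sup => _ [Q [mQ _] <-].
  have [d nullP] := rdd_null_tilt m mX Xc mQ.
  have phiM z : `|phi z| <= 1 by have /andP[? ?] := phi01 z; rewrite ger0_norm.
  (* Each tilted law is in the null class, so the power at [Q] is a limit of numbers bounded by the
     size. *)
  have cphi := cvg_expectation_tilt d mQ mphi phiM.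
  rewrite -(cvg_lim _ cphi)//; apply: lime_le.
    by apply/cvg_ex; eexists; exact: cphi.
  by near=> k; apply: ereal_sup_ubound; exists (distribution Q (tilt c d k.+1%:R)).
- apply/eqP; rewrite eq_le; apply/andP; split; last first.
    by apply: le_ereal_inf_tmp => _ [P _ <-].
  rewrite leNgt; apply/negP => inf_gt0.
  have [Q mQ] := rdd_model_nonempty mX Xc.
  set inf := ereal_inf _ in inf_gt0.
  have infP P : rdd_model X c P ->
      (inf <= product_power P n [set z | C z (rdd_mu X c P)])%E.
    by move=> mP; apply: ereal_inf_lbound; exists P.
  have inf_fin : inf \is a fin_num.
    rewrite ge0_fin_numE ?ltW//; apply: le_lt_trans (infP Q mQ) _.
    by rewrite -ge0_fin_numE// fin_num_measure//; exact: confC.1.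
  apply: (coverage_not_bounded_below (b := fine inf) confC (finC Q mQ)).
    by rewrite fine_gt0// inf_gt0 -ge0_fin_numE// ltW.
  move=> m; rewrite fineK//.
  have mCm : measurable [set z | C z m] by exact: confC.1.
  (* Each law tilted towards [m] has parameter [m], hence covers [m] with probability at least
     [inf]; the limit, taken on the indicator of that event, carries the bound to the fixed law
     [Q]. *)
  have [d nullP] := rdd_null_tilt m mX Xc mQ.
  have indic_le1 z : `|\1_[set z | C z m] z| <= 1 :> R.
    by rewrite indicE; case: (z \in _); rewrite ?normr1 ?normr0.
  have cphi := cvg_expectation_tilt d mQ (measurable_indic mCm) indic_le1.
  rewrite -(expectation_indic _ mCm) -(cvg_lim _ cphi)//.
  apply: lime_ge; first by apply/cvg_ex; eexists; exact: cphi.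
  near=> k; rewrite expectation_indic//.
  by have [mP <-] := nullP k.+1%:R; exact: infP.
Unshelve. all: by end_near. Qed.
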